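(* Suppose that $n$ is odd and $k\equiv 2\pmod 4$. If $A\in\Lambda_n^k$, then $$\operatorname{per} A(a \mid c)+\operatorname{per} A(b \mid c)+\operatorname{per} A(a \mid d)+\operatorname{per} A(b \mid d) \equiv 0 \pmod 4$$ for any $a,b,c,d\in\{1,\dots,n\}$.
   Context: $\Lambda_n^{k}$ denotes the set of all $(0,1)$-matrices of order $n$ (i.e. $n\times n$) that contain exactly $k$ ones in each row and each column. $A(i\mid j)$ denotes the matrix obtained from $A$ by deleting row $i$ and column $j$. The permanent of an $m\times m$ matrix $M=[m_{ij}]$ is $\operatorname{per} M=\sum_{\sigma\in \mathcal{S}_m}\prod_{i=1}^m m_{i\sigma(i)}$, where $\mathcal{S}_m$ is the symmetric group on $\{1,\dots,m\}$. *)

(* Defs.v *)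
From mathcomp Require Import all_boot all_order all_algebra all_fingroup.
Set Implicit Arguments.
Unset Strict Implicit.
Unset Printing Implicit Defensive.
Import GRing.Theory.
Local Open Scope ring_scope.

Definition permanent (R : comNzRingType) (m : nat) (M : 'M[R]_m) : R :=
  \sum_(s : 'S_m) \prod_(i < m) M i (s i).

(* The matrices are taken over int so that row and column operations remain
   available on them. *)
Definition Lambda (n k : nat) (A : 'M[int]_n) : Prop :=
  [/\ forall i j, A i j = 0 \/ A i j = 1,
      forall i, #|[set j | A i j == 1]| = k
    & forall j, #|[set i | A i j == 1]| = k].

Definition minor_mx (R : Type) (n : nat) (A : 'M[R]_n) (i j : 'I_n) :
  'M[R]_n.-1 := row' i (col' j A).

(* Main.v *)
Require Import Defs.
From HB Require Import structures.
From mathcomp Require Import all_boot all_order all_algebra all_fingroup.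
From mathcomp Require Import zify ring.
Set Implicit Arguments.
Unset Strict Implicit.
Unset Printing Implicit Defensive.
Import GRing.Theory.
Local Open Scope ring_scope.

(** All column sums of [A] are even, and the permanent is multilinear in the
    columns.  With [permcol M p x] the permanent of [M] with column [p] replaced
    by [x], the minor at [(i, p)] has permanent [permcol M p e_i].

    Write [u = e_a + e_b].  If [c = d], the sum is twice the permanent of a
    matrix all of whose column sums are even, and such a permanent is even
    because modulo 2 it is the determinant of a matrix whose rows add up to zero
    ([permanent_even_col_sums]).

    Let [c != d], and let [B y] be the permanent of [A] with columns [c] and
    [d] replaced by [u] and [y].  By multilinearity and symmetry the sum is
    [B A_c + B A_d], where [A_j] is column [j] of [A].  Put [D = B e_a].
    - For [j] other than [c] and [d], the matrix of [B A_j] has two equal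
      columns, and [permcol_duplicate] gives [B A_j = 2 D] modulo 4.
    - Since every row sum is [k], the [A_j] add up to [k (e_1 + ... + e_n)].
      The numbers [B e_i] all have the parity of [D], because [B (e_i - e_a)]
      is a permanent with even column sums; as [k = 2] modulo 4, this gives
      [k B e_i = 2 D] modulo 4.  So the sum of [B A_j - 2 D] over all [j] is
      0 modulo 4.
    Subtracting, [B A_c + B A_d = 4 D = 0] modulo 4.

    The heart of the proof is [permcol_duplicate].  For [M] with columns [p]
    and [q] replaced by vectors, the permanent is a symmetric bilinear form
    [B], even on pairs of vectors with even coordinate sum when the other
    columns have even sums.  Hence [B y y] is additive modulo 4 on such vectors
    ([even_form_sum]).  If the repeated
    column is [x], apply this to [x - (sum x) e_i], which is the sum of the
    [x_s (e_s - e_i)]; the values [B (e_s - e_i) (e_s - e_i)] are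
    [- 2 B e_s e_i], since [B e_s e_s = 0]. *)

(** * Permanents as multilinear functions of the columns *)

Section PermanentColumns.

Variables (R : comNzRingType) (n : nat).
Implicit Types (M : 'M[R]_n) (p q : 'I_n) (x y : 'cV[R]_n).

Definition repcol M p x : 'M[R]_n :=
  \matrix_(i, j) if j == p then x i 0 else M i j.

Definition permcol M p x : R := permanent (repcol M p x).

Lemma repcol_col M p : repcol M p (col p M) = M.
Proof. by apply/matrixP => i j; rewrite !mxE; case: eqP => [->|]. Qed.

Lemma col_repcol_eq M p x : col p (repcol M p x) = x.
Proof. by apply/matrixP => i j; rewrite !mxE eqxx ord1. Qed.

Lemma col_repcol M p q x : p != q -> col q (repcol M p x) = col q M.
Proof.
by move=> pq; apply/matrixP => i j; rewrite !mxE eq_sym (negPf pq).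
Qed.

Lemma permanent_bycol M : permanent M = \sum_(s : 'S_n) \prod_j M (s j) j.
Proof.
rewrite /permanent (reindex_inj invg_inj) /=; apply: eq_bigr => s _.
by rewrite (reindex_inj (@perm_inj _ s)); apply: eq_bigr => j _; rewrite permK.
Qed.

Lemma permcolE M p x :
  permcol M p x = \sum_(s : 'S_n) x (s p) 0 * \prod_(j | j != p) M (s j) j.
Proof.
rewrite /permcol permanent_bycol; apply: eq_bigr => s _.
rewrite (bigD1 p) //= mxE eqxx; congr (_ * _).
by apply: eq_bigr => j /negPf jp; rewrite mxE jp.
Qed.

Lemma permcol_is_scalar M p : scalar (permcol M p).
Proof.
move=> a x y; rewrite !permcolE mulr_sumr -big_split /=; apply: eq_bigr => s _.
by rewrite !mxE mulrDl mulrA.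
Qed.

HB.instance Definition _ M p :=
  GRing.isLinear.Build R 'cV[R]_n R *%R (permcol M p) (@permcol_is_scalar M p).

Lemma permanent_permcol M p : permanent M = permcol M p (col p M).
Proof. by rewrite /permcol repcol_col. Qed.

Lemma permcol_swap M p q x y : p != q ->
  permcol (repcol M p x) q y = permcol (repcol M p y) q x.
Proof.
move=> pq; rewrite /permcol !permanent_bycol.
rewrite (reindex_inj (mulgI (tperm p q))) /=; apply: eq_bigr => s _.
rewrite (reindex_inj (@perm_inj _ (tperm p q))) /=; apply: eq_bigr => j _.
rewrite permM tpermK !mxE.
case: tpermP => [->|->|/eqP/negPf-> /eqP/negPf-> //].
  by rewrite !eqxx (negPf pq).
by rewrite !eqxx (negPf pq).
Qed.

(** No permutation meets two columns in the same row. *)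
Lemma permcol_delta2 M p q i : p != q ->
  permcol (repcol M p (delta_mx i 0)) q (delta_mx i 0) = 0.
Proof.
move=> pq; rewrite permcolE big1 // => s _.
rewrite (bigD1 p) //= !mxE !eqxx !andbT.
case: (eqVneq (s q) i) => [<-|]; last by rewrite mul0r.
by rewrite (inj_eq perm_inj) (negPf pq) mul0r mulr0.
Qed.

End PermanentColumns.

Lemma perm_lift_perm n (p i : 'I_n.+1) (s : 'S_n.+1) :
  s p = i -> exists t, s = lift_perm p i t.
Proof.
move=> spi; pose f k := odflt k (unlift i (s (lift p k))).
have fK k : lift i (f k) = s (lift p k).
  rewrite /f; case: unliftP => [l -> //|/eqP].
  by rewrite -spi (inj_eq perm_inj) eq_sym (negPf (neq_lift _ _)).
have f_inj : injective f.
  by move=> k l /(congr1 (lift i)); rewrite !fK => /perm_inj/lift_inj.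
exists (perm f_inj); apply/permP => k.
case: (unliftP p k) => [l|] ->; first by rewrite lift_perm_lift permE fK.
by rewrite lift_perm_id.
Qed.

(** Laplace expansion of a unit column: only the permutations sending [p] to
    [i] contribute, and [lift_perm] identifies them with those of the minor. *)
Lemma permanent_minor (R : comNzRingType) n (M : 'M[R]_n) i p :
  permanent (minor_mx M i p) = permcol M p (delta_mx i 0).
Proof.
case: n => [|n] in M i p *; first by case: i.
rewrite permanent_bycol permcolE [RHS](bigID (fun s : 'S__ => s p == i)) /=.
rewrite [X in _ + X]big1 ?addr0 => [|s /negPf spi]; last first.
  by rewrite mxE spi mul0r.
have lift_perm_inj : injective (lift_perm p i).
  move=> s t /permP st; apply/permP => k.
  by apply: (@lift_inj _ i); rewrite -!(lift_perm_lift p) st.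
transitivity (\sum_(s in [set lift_perm p i t | t : 'S_n])
                \prod_(j | j != p) M (s j) j).
  rewrite big_imset /=; last by move=> s t _ _; apply: lift_perm_inj.
  apply: eq_bigr => s _.
  rewrite (reindex_omap (lift p) (unlift p)) /=; last first.
    by move=> j; rewrite eq_sym => /unlift_some[k -> _]; rewrite liftK.
  apply: eq_big => [k|k _]; first by rewrite eq_sym neq_lift liftK eqxx.
  by rewrite !mxE lift_perm_lift.
apply: eq_big => [s|s /imsetP[t _ ->]]; last first.
  by rewrite lift_perm_id mxE !eqxx mul1r.
apply/imsetP/eqP => [[t _ ->]|/perm_lift_perm[t ->]]; first exact: lift_perm_id.
by exists t.
Qed.

(** * Parity *)

Definition even_sum n (x : 'cV[int]_n) : bool := (2 %| \sum_i x i ord0)%Z.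

Lemma even_sum_repcol n (M : 'M[int]_n) p x j :
  even_sum x -> (j != p -> even_sum (col j M)) ->
  even_sum (col j (repcol M p x)).
Proof.
move=> evx evM; have [->|jp] := eqVneq j p; first by rewrite col_repcol_eq.
by rewrite col_repcol 1?eq_sym // evM.
Qed.

Lemma sum_delta n (i : 'I_n) : \sum_s (delta_mx i 0 : 'cV[int]_n) s ord0 = 1.
Proof.
rewrite (bigD1 i) //= mxE !eqxx big1 // => s /negPf si; by rewrite mxE si.
Qed.

Lemma even_sum_delta_sub n (i j : 'I_n) :
  even_sum (delta_mx i 0 - delta_mx j 0).
Proof.
rewrite /even_sum.
have -> : \sum_s (delta_mx i 0 - delta_mx j 0 : 'cV[int]_n) s ord0 = 0.
  by under eq_bigr do rewrite mxE [X in _ + X]mxE; rewrite sumrB !sum_delta.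
exact: dvdz0.
Qed.

(** Signs disappear in characteristic 2. *)
Lemma permanent_det2 n (M : 'M[int]_n) :
  (2 %| permanent M)%Z = (\det (map_mx intr M) == 0 :> 'F_2).
Proof.
rewrite (dvdz_pcharf (pchar_Fp (isT : prime 2))).
rewrite /permanent /determinant rmorph_sum.
congr (_ == _); apply: eq_bigr => s _.
rewrite rmorph_prod (_ : -1 = 1 :> 'F_2); last exact/val_inj.
by rewrite expr1n mul1r; apply: eq_bigr => i _; rewrite mxE.
Qed.

(** Modulo 2 the all-ones row vector is in the left kernel. *)
Lemma permanent_even_col_sums n (M : 'M[int]_n) :
  (0 < n)%N -> (forall j, even_sum (col j M)) -> (2 %| permanent M)%Z.
Proof.
case: n M => // n M _ evM; rewrite permanent_det2; apply/det0P.
exists (const_mx 1).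
  by apply/eqP => /rowP/(_ ord0)/eqP; rewrite !mxE oner_eq0.
apply/rowP => j; rewrite !mxE; apply/eqP.
have := evM j.
rewrite /even_sum (dvdz_pcharf (pchar_Fp (isT : prime 2))) rmorph_sum.
congr (_ == _); apply: eq_bigr => i _; by rewrite !mxE mul1r.
Qed.

(** * A congruence modulo 4 for a repeated column *)

(** Each cross term [B (v s) (v t)] occurs twice, hence is 0 modulo 4. *)
Lemma even_form_sum (V : zmodType) (B : V -> V -> int) (I : Type)
    (r : seq I) (v : I -> V) :
  (forall x y, B x y = B y x) -> (forall x, {morph B x : y z / y + z}) ->
  (forall s t, (2 %| B (v s) (v t))%Z) ->
  (4 %| B (\sum_(s <- r) v s) (\sum_(s <- r) v s)
        - \sum_(s <- r) B (v s) (v s))%Z.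
Proof.
move=> BC BD Bv.
have B0 x : B x 0 = 0 by have := BD x 0 0; rewrite addr0; lia.
elim: r => [|s r IHr]; first by rewrite !big_nil B0.
rewrite !big_cons; set y := \sum_(t <- r) v t in IHr *.
have Bsy : (2 %| B (v s) y)%Z.
  by rewrite /y; elim/big_rec: _ => [|t z _ IH]; rewrite ?B0 ?BD ?rpredD.
rewrite BD (BC _ (v s)) (BC _ y) !BD (BC y (v s)).
move: IHr Bsy; move: (B (v s) y) (B y y) (B (v s) (v s)) (\sum_(t <- r) _).
lia.
Qed.

Lemma cV_sub_delta n (x : 'cV[int]_n) i :
  \sum_s x s 0 *: (delta_mx s 0 - delta_mx i 0)
    = x - (\sum_s x s 0) *: delta_mx i 0.
Proof.
under eq_bigr do rewrite scalerBr.
rewrite sumrB -scaler_suml; congr (_ - _).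
by rewrite [RHS]matrix_sum_delta; apply: eq_bigr => s _; rewrite big_ord1.
Qed.

(** The coordinates of [x] enter the diagonal terms through their squares, while
    the right-hand side is linear in them; this is harmless because the terms
    carry a factor 2 and [a ^ 2] and [a] have the same parity. *)
Lemma permcol_duplicate n (M : 'M[int]_n) (p q i : 'I_n) :
  p != q -> (forall j, j != p -> even_sum (col j M)) ->
  (4 %| (permcol M p (col q M) - 2 * permcol M p (delta_mx i 0))%R)%Z.
Proof.
move=> pq evM; set x := col q M.
pose B y z := permcol (repcol M p y) q z.
have BC y z : B y z = B z y by apply: permcol_swap.
have BD y : {morph B y : z t / z + t} by move=> z t; apply: linearD.
have BZ y a z : B y (a *: z) = a * B y z by apply: linearZ.
have BN y z : B y (- z) = - B y z by apply: linearN.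
have Bx y : permcol M p y = B y x.
  by rewrite /B /x -(col_repcol M y pq) -permanent_permcol.
have evB y z : even_sum y -> even_sum z -> (2 %| B y z)%Z.
  move=> evy evz; apply: permanent_even_col_sums => [|j].
    exact: leq_ltn_trans (ltn_ord i).
  by apply: even_sum_repcol => // _; apply: even_sum_repcol => // /evM.
pose e s : 'cV[int]_n := delta_mx s 0; pose X := \sum_s x s 0.
have Bee s : B (e s) (e s) = 0 by apply: permcol_delta2.
pose v s := x s 0 *: (e s - e i).
have evw s : even_sum (e s - e i) by apply: even_sum_delta_sub.
have := @even_form_sum _ B _ (index_enum 'I_n) v BC BD.
have Bvv s t : B (v s) (v t) = x s 0 * x t 0 * B (e s - e i) (e t - e i).
  by rewrite /v BZ BC BZ BC; ring.
have {}Bv : forall s t, (2 %| B (v s) (v t))%Z.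
  by move=> s t; rewrite Bvv dvdz_mull // evB.
move=> /(_ Bv).
rewrite {1 2}/v cV_sub_delta -/X.
have evX : (2 %| X)%Z.
  by have := evM q; rewrite eq_sym => /(_ pq).
have Bix : B (e i) x = \sum_s x s 0 * B (e i) (e s).
  rewrite {1}[x]matrix_sum_delta.
  under eq_bigr do rewrite big_ord1.
  rewrite /B linear_sum; apply: eq_bigr => s _; exact: linearZ.
have diag : (4 %| \sum_s B (v s) (v s) - 2 * B (e i) x)%Z.
  rewrite Bix mulr_sumr -sumrB; apply: rpred_sum => s _.
  rewrite Bvv BD BN BC BD BN Bee (BC (e s - e i)) BD BN Bee (BC (e s)).
  set g := B _ _; set a := x s 0.
  (* The goal compares [- 2 a ^ 2 g] with [2 a g]. *)
  have /dvdzP[m am] : (2 %| (a * (a + 1))%R)%Z.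
    have [a_ev|a_od] : (2 %| a)%Z \/ (2 %| (a + 1)%R)%Z by lia.
      exact: dvdz_mulr.
    exact: dvdz_mull.
  apply/dvdzP; exists (- (m * g)); nia.
(* The coefficient [2 * X] below is 0 modulo 4 because [X], the sum of [x], is
   even. *)
have -> : B (x - X *: e i) (x - X *: e i) = B x x - 2 * X * B (e i) x.
  rewrite BD BN BZ (BC _ x) (BC _ (e i)) !BD !BN !BZ Bee (BC x (e i)); ring.
rewrite !Bx -/(e i) => form.
have XB : (4 %| (2 * X * B (e i) x)%R)%Z by apply: dvdz_mulr; lia.
have -> : B x x - 2 * B (e i) x =
  (B x x - 2 * X * B (e i) x - \sum_s B (v s) (v s))
  + (\sum_s B (v s) (v s) - 2 * B (e i) x) + 2 * X * B (e i) x by ring.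
by apply: rpredD => //; apply: rpredD.
Qed.

(** * The four minors *)

Theorem theorem19 (n k : nat) (hn : odd n) (hk : k = 2 %[mod 4])
    (A : 'M[int]_n) (hA : Lambda k A) (a b c d : 'I_n) :
  (permanent (minor_mx A a c) + permanent (minor_mx A b c)
   + permanent (minor_mx A a d) + permanent (minor_mx A b d) = 0 %[mod 4])%Z.
Proof.
case: hA => A01 rowA colA.
have indA i j : A i j = (A i j == 1)%:R by case: (A01 i j) => ->.
have sum_row i : \sum_j A i j = k%:R.
  rewrite -(rowA i) -sum1dep_card natr_sum [RHS]big_mkcond /=.
  by apply: eq_bigr => j _; rewrite {1}indA; case: eqP.
have sum_col j : \sum_i A i j = k%:R.
  rewrite -(colA j) -sum1dep_card natr_sum [RHS]big_mkcond /=.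
  by apply: eq_bigr => i _; rewrite {1}indA; case: eqP.
have evA j : even_sum (col j A).
  by rewrite /even_sum; under eq_bigr do rewrite mxE; rewrite sum_col natz; lia.
apply/eqP; rewrite eqz_mod_dvd subr0 !permanent_minor.
pose e s : 'cV[int]_n := delta_mx s 0; pose u := e a + e b.
have evu : even_sum u.
  rewrite /even_sum; under eq_bigr do rewrite mxE.
  by rewrite big_split !sum_delta.
have n_gt0 : (0 < n)%N by exact: leq_ltn_trans (ltn_ord a).
have evcol p x : even_sum x -> (2 %| permcol A p x)%Z.
  by move=> evx; apply: permanent_even_col_sums => // j; apply: even_sum_repcol.
rewrite -addrA -![X in X + _]linearD -/(e a) -/(e b) /=.
rewrite -!linearD -/u /=.
have [<-|cd] := eqVneq c d.
  have := evcol c u evu; move: (permcol A c u) => P; lia.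
pose B := permcol (repcol A c u) d.
have Bd : permcol A c u = B (col d A).
  by rewrite /B -(col_repcol A u cd) -permanent_permcol.
have Bc : permcol A d u = B (col c A).
  by rewrite /B permcol_swap // repcol_col.
rewrite Bd Bc; pose D := B (e a).
have B_e i : (4 %| (k%:R * B (e i) - 2 * D)%R)%Z.
  have : (2 %| B (e i - e a))%Z.
    apply: permanent_even_col_sums => // j.
    apply: even_sum_repcol => [|_]; first exact: even_sum_delta_sub.
    exact: even_sum_repcol.
  rewrite /B linearB /= -/B -/D.
  move: (B (e i)) => m ev.
  have -> : k%:R * m - 2 * D = k%:R * (m - D) + (k%:R - 2) * D by ring.
  apply: rpredD; last by apply: dvdz_mulr; rewrite natz; lia.
  by apply: (@dvdz_mul 2 2) => //; rewrite natz; lia.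
have B_col j : j != c -> j != d -> (4 %| (B (col j A) - 2 * D)%R)%Z.
  move=> jc jd; rewrite -(col_repcol A u (_ : c != j)) 1?eq_sym //.
  apply: permcol_duplicate; first by rewrite eq_sym.
  by move=> l _; apply: even_sum_repcol.
have sumB : \sum_j B (col j A) = \sum_i k%:R * B (e i).
  rewrite -linear_sum.
  have -> : \sum_j col j A = \sum_i k%:R *: e i.
    apply/colP => s; rewrite summxE -scaler_sumr !mxE.
    under eq_bigr do rewrite mxE.
    rewrite sum_row summxE (bigD1 s) //= mxE !eqxx big1 ?addr0 ?mulr1 // => i.
    by rewrite mxE eq_sym => /negPf ->.
  by rewrite linear_sum; apply: eq_bigr => i _; exact: linearZ.
have tot : (4 %| (\sum_j (B (col j A) - 2 * D))%R)%Z.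
  by rewrite sumrB sumB -sumrB; apply: rpred_sum => i _; apply: B_e.
move: tot; rewrite (bigD1 c) //= (bigD1 d) 1?eq_sym //=.
have rest : (4 %| (\sum_(j | (j != c) && (j != d)) (B (col j A) - 2 * D))%R)%Z.
  by apply: rpred_sum => j /andP[jc jd]; apply: B_col.
rewrite addrA (rpredDr _ rest) => cd_part.
have -> : B (col d A) + B (col c A)
  = (B (col c A) - 2 * D + (B (col d A) - 2 * D)) + 4 * D by ring.
by apply: rpredD => //; apply: dvdz_mulr.
Qed.
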